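(* Let $G$ be a non-cyclic finite group of order $n$. Then $$\psi(G)\leq \frac{7}{11}\psi(C_n).$$ Moreover, equality holds if and only if $n=4k$ for some positive integer $k$ with $(k,2)=1$ and $G\cong (C_2\times C_2)\times C_k$.
   Context: All groups are finite. For a finite group $G$, $\psi(G)=\sum_{x\in G} o(x)$, where $o(x)$ denotes the order of the element $x$. $C_m$ denotes the cyclic group of order $m$. $(a,b)$ denotes the greatest common divisor of the integers $a,b$. *)

(* Defs.v *)
From mathcomp Require Import all_boot all_order all_algebra all_fingroup all_solvable.

Set Implicit Arguments.
Unset Strict Implicit.
Unset Printing Implicit Defensive.

Local Open Scope group_scope.

Definition psi (gT : finGroupType) (G : {group gT}) : nat :=
  (\sum_(x in G) #[x])%N.

(* The group [Zp m] is the additive group of integers mod m for every m > 0;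
   it is trivial for m = 1, although its ambient type 'Z_1 is 'Z_2. *)
Definition cyc (m : nat) : {group 'Z_m} := [group of Zp m].

Definition dprodX (gT1 gT2 : finGroupType) (H1 : {group gT1})
    (H2 : {group gT2}) : {group (gT1 * gT2)} :=
  [group of setX H1 H2].

(* Main.v *)
Require Import Defs.
From mathcomp Require Import all_boot all_order all_algebra all_fingroup all_solvable.
From mathcomp Require Import zify lra.

(** Write n for the order of G and C_n for the cyclic group.  The proof is by
induction on n, in the form [near_extremal]: if a non-cyclic G satisfies
7 psi(C_n) <= 11 psi(G), then equality holds and G is the direct product of a
Klein group and a cyclic group of odd order.

The average order in G is psi(G)/n, while psi(C_n) is large: if all prime
divisors of n are at most m, then psi(C_n) >= 2 n^2/(m+1) [psi_cyc_ge], by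
telescoping the product of the factors p/(p+1) over all integers up to m.  So
a group with psi(G) near psi(C_n) has a cyclic subgroup X with
14 |G : X| <= 11 (m+1) [large_order_element].  Let p be the largest prime
divisor of n.

If p = 2, then G is a 2-group with a cyclic subgroup of index 2, and counting
leaves only order 4 [near_extremal_2group].

If p > 2, then |G : X| < p, except that the index may be 3 when p = 3.  In the
first case X normalizes a Sylow p-subgroup of G, whose number of conjugates is
then below p and 1 mod p: it is normal.  In the exceptional case either G is a
3-group, or n is even and half of X is too far from being of maximal order
[psi_even_index3_lt].  Thus the Sylow p-subgroup P is normal in all cases, and
G is a semidirect product of P by a complement F.

- If P is not cyclic, its elements have order at most |P|/p, which makes psi(G)
  too small [psi_noncyclic_Sylow_lt].
- If P is cyclic, an element of F that does not centralize P fixes only 1 in P,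
  so its order is the order of every element in its coset.  This gives an exact
  formula for psi(G) [psi_sdprod_cyclic_pgroup], hence psi(G) <= psi(P) psi(F),
  with equality exactly when F centralizes P.
  + If F is cyclic, G is not abelian and the formula bounds psi(G) by
    13/21 psi(C_n), and 13/21 < 7/11 [psi_cyclic_by_cyclic_lt].
  + If F is not cyclic, the induction hypothesis applies to F; equality must
    hold everywhere, so that P is a direct factor of G. *)

Set Implicit Arguments.
Unset Strict Implicit.
Unset Printing Implicit Defensive.

Import GroupScope.
Local Open Scope nat_scope.

(** * Elementary properties of psi *)

Lemma psi_gt0 (gT : finGroupType) (G : {group gT}) : 0 < psi G.
Proof. by rewrite /psi (bigD1 1%g) //= order1. Qed.

Lemma psi_isog (gT rT : finGroupType) (G : {group gT}) (H : {group rT}) :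
  G \isog H -> psi G = psi H.
Proof.
case/isogP=> f injf defH; rewrite /psi -{}defH morphimEdom.
rewrite big_imset /=; last exact/injmP.
by apply: eq_bigr => x Gx; rewrite order_injm.
Qed.

Lemma psi_subset (gT : finGroupType) (H G : {group gT}) :
  H \subset G -> psi H <= psi G.
Proof.
by move=> sHG; rewrite /psi [leqRHS](big_setID H) /= (setIidPr sHG) leq_addr.
Qed.

Lemma psi_proper (gT : finGroupType) (H G : {group gT}) :
  H \proper G -> psi H < psi G.
Proof.
case/properP=> sHG [x Gx nHx].
rewrite /psi [ltnRHS](big_setID H) /= (setIidPr sHG) -[ltnLHS]addn0 ltn_add2l.
by rewrite (bigD1 x) ?inE ?Gx ?nHx //= ltn_addr ?order_gt0.
Qed.

Lemma psi_le_mul (gT : finGroupType) (G : {group gT}) m :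
  {in G, forall x, #[x] <= m} -> psi G <= #|G| * m.
Proof. by move=> le_m; rewrite -sum_nat_const /psi; apply: leq_sum. Qed.

Lemma psi_le_sqr (gT : finGroupType) (G : {group gT}) : psi G <= #|G| ^ 2.
Proof.
by apply: psi_le_mul => x Gx; rewrite dvdn_leq ?cardG_gt0 ?order_dvdG.
Qed.

Lemma psi_setD (gT : finGroupType) (H G : {group gT}) :
  H \subset G -> psi G = psi H + \sum_(x in G :\: H) #[x].
Proof. by move=> sHG; rewrite /psi [LHS](big_setID H) /= (setIidPr sHG). Qed.

Lemma cyc_cyclic m : cyclic (cyc m).
Proof.
rewrite /cyc /Zp /=; case: ifP => _; last by rewrite cyclic1.
by rewrite [[set: _]]Zp_cycle cycle_cyclic.
Qed.

Lemma card_cyc m : 0 < m -> #|cyc m| = m.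
Proof. exact: card_Zp. Qed.

Lemma psi_cyclic (gT : finGroupType) (G : {group gT}) :
  cyclic G -> psi G = psi (cyc #|G|).
Proof.
move=> cycG; apply: psi_isog.
by rewrite isog_cyclic_card // cyc_cyclic card_cyc //=.
Qed.

(** * Semidirect products with a normal p-subgroup *)

Lemma psi_sdprod_sum (gT : finGroupType) (G P F : {group gT}) :
  P ><| F = G -> psi G = \sum_(f in F) \sum_(u in P) #[(u * f)%g].
Proof.
case/sdprodP=> _ defG _ tiPF.
rewrite exchange_big /= pair_big_dep /= /psi -defG.
rewrite (reindex_onto (fun z => (z.1 * z.2)%g)
   (fun x => (divgr P F x, remgr P F x))) /=; last first.
  by move=> x _; rewrite -divgr_eq.
apply: eq_bigl => [[u f]] /=; rewrite xpair_eqE.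
apply/idP/idP=> [/and3P[PFx /eqP eu /eqP ef]|/andP[Pu Ff]].
  by rewrite -{1}eu mem_divgr // -ef mem_remgr.
by rewrite mem_mulg //= divgrMid ?remgrMid ?eqxx.
Qed.

Lemma psi_dprod (gT : finGroupType) (G A B : {group gT}) :
  A \x B = G -> coprime #|A| #|B| -> psi G = psi A * psi B.
Proof.
move=> defG coAB; have [_ _ cAB _] := dprodP defG.
rewrite (psi_sdprod_sum (etrans (esym (dprodEsd cAB)) defG)) mulnC.
rewrite /psi big_distrl /=; apply: eq_bigr => f Ff.
rewrite big_distrr /=; apply: eq_bigr => u Au; rewrite mulnC orderM //.
  exact/commute_sym/(centsP cAB).
by rewrite (coprime_dvdl (order_dvdG Au)) // (coprime_dvdr (order_dvdG Ff)).
Qed.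

(** By coprimality [~: P, A] meets 'C_P(A) trivially; but any two nontrivial
subgroups of a cyclic p-group share its unique subgroup of order p, and
[~: P, A] is nontrivial. *)
Lemma cyclic_pgroup_cent_TI (gT : finGroupType) (p : nat) (P A : {group gT}) :
    p.-group P -> cyclic P -> A \subset 'N(P) -> coprime #|P| #|A| ->
  ~~ (A \subset 'C(P)) -> 'C_P(A) = 1%g.
Proof.
move=> pP cycP nPA coPA ncPA.
have tiC := coprime_abel_cent_TI nPA coPA (cyclic_abelian cycP).
have ntP : P :!=: 1%g by apply: contraNneq ncPA => ->; rewrite cents1.
have [p_pr _ _] := pgroup_pdiv pP ntP.
have prO : prime #|'Ohm_1(P)| by rewrite (Ohm1_cyclic_pgroup_prime cycP pP).
have sRP : [~: P, A] \subset P by rewrite commg_subl.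
case: (prime_subgroupVti [group of 'C_P(A)] prO) => /= [sOC | /TI_Ohm1 ti].
  case: (prime_subgroupVti [group of [~: P, A]] prO) => /= [sOR | /TI_Ohm1].
    have: 'Ohm_1(P) \subset 'C_[~: P, A](A).
      by rewrite subsetI sOR (subset_trans sOC) ?subsetIr.
    by rewrite tiC => /trivgP O1; rewrite O1 cards1 in prO.
  by rewrite setIC (setIidPr sRP) => /commG1P; rewrite centsC (negPf ncPA).
by rewrite -(setIidPr (subsetIl P 'C(A))) setIC.
Qed.

Lemma coset_mulX (gT : finGroupType) (P : {group gT}) u f i :
  u \in P -> f \in 'N(P) -> coset P ((u * f) ^+ i) = coset P (f ^+ i).
Proof.
move=> Pu Nf; have Nu := subsetP (normG P) u Pu.
by rewrite !morphX ?groupM //= morphM //= (coset_id Pu) mul1g.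
Qed.

Lemma expg_mul_norm (gT : finGroupType) (P : {group gT}) u f :
  u \in P -> f \in 'N(P) -> (u * f) ^+ #[f] \in P.
Proof.
move=> Pu Nf; have Nu := subsetP (normG P) u Pu.
by rewrite coset_idr ?groupX ?groupM // coset_mulX // expg_order morph1.
Qed.

(** When f does not centralize P, the power (u * f) ^+ #[f] lies in P and is
fixed by f, so it is trivial: every element of the coset of f has order #[f].
When f centralizes P, orders are multiplicative on the coset. *)
Lemma psi_sdprod_cyclic_pgroup (gT : finGroupType) (p : nat)
    (G P F : {group gT}) :
    P ><| F = G -> p.-group P -> cyclic P -> coprime #|P| #|F| ->
  psi G = psi P * psi 'C_F(P)%G + #|P| * \sum_(f in F :\: 'C(P)) #[f].
Proof.
move=> defG pP cycP coPF; have [_ _ nPF tiPF] := sdprodP defG.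
rewrite (psi_sdprod_sum defG) (big_setID 'C(P)) /=.
congr (_ + _).
  rewrite /psi mulnC big_distrl /=; apply: eq_bigr => f /setIP[Ff cPf].
  rewrite big_distrr /=; apply: eq_bigr => u Pu.
  rewrite mulnC orderM //; first exact/commute_sym/(centP cPf).
  by rewrite (coprime_dvdl (order_dvdG Pu)) // (coprime_dvdr (order_dvdG Ff)).
rewrite big_distrr /=; apply: eq_bigr => f /setDP[Ff ncPf].
rewrite -sum_nat_const; apply: eq_bigr => u Pu.
have nPf : <[f]> \subset 'N(P) by rewrite cycle_subG (subsetP nPF).
have tiC : 'C_P(<[f]>) = 1%g.
  apply: cyclic_pgroup_cent_TI pP cycP nPf _ _; last by rewrite cycle_subG.
  exact: coprime_dvdr (order_dvdG Ff) coPF.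
have Nf : f \in 'N(P) by apply: (subsetP nPF).
(* Modulo P both elements coincide, and a power of f that lies in P is 1. *)
apply/eqP; rewrite eqn_dvd !order_dvdn.
apply/andP; split; apply/eqP.
  apply/set1gP; rewrite -tiC inE expg_mul_norm // cent_cycle.
  apply/cent1P.
  have cu : commute ((u * f) ^+ #[f]) u.
    by apply: (centsP (cyclic_abelian cycP)); rewrite ?expg_mul_norm.
  have cuf : commute ((u * f) ^+ #[f]) (u * f).
    by apply/commute_sym/commuteX.
  by have := commuteM (commuteV cu) cuf; rewrite mulKg.
apply/set1gP; rewrite -tiPF inE (groupX _ Ff) andbT.
rewrite coset_idr ?groupX //.
by rewrite -(coset_mulX _ Pu Nf) expg_order morph1.
Qed.

(** An element u * f has a #[f]-th power in P, and elements of P have order at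
most |P|/p as P is not cyclic. *)
Lemma psi_sdprod_noncyclic_pgroup (gT : finGroupType) (p : nat)
    (G P F : {group gT}) :
    prime p -> P ><| F = G -> p.-group P -> ~~ cyclic P ->
  p * psi G <= #|P| ^ 2 * psi F.
Proof.
move=> p_pr defG pP ncP; have [_ _ nPF tiPF] := sdprodP defG.
have leP u : u \in P -> p * #[u] <= #|P|.
  move=> Pu; have [n oP] := p_natP pP; have := order_dvdG Pu.
  rewrite {1}oP => /(dvdn_pfactor _ _ p_pr)[m le_mn ou].
  rewrite ou oP -expnS leq_exp2l ?prime_gt1 //.
  rewrite ltn_neqAle le_mn andbT; apply: contra ncP => /eqP eq_mn.
  apply/cyclicP; exists u; apply/esym/eqP.
  by rewrite eqEcard cycle_subG Pu -orderE ou oP eq_mn /=.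
rewrite (psi_sdprod_sum defG) big_distrr /= /psi big_distrr /=.
apply: leq_sum => f Ff; rewrite big_distrr /= expnS expn1 -mulnA -sum_nat_const.
apply: leq_sum => u Pu.
have Puf := expg_mul_norm Pu (subsetP nPF f Ff).
have := leP _ Puf; rewrite orderXgcd => le1.
have : #[(u * f)%g] <= #[f] * (#[(u * f)%g] %/ gcdn #[(u * f)%g] #[f]).
  rewrite -{1}(divnK (dvdn_gcdl #[(u * f)%g] #[f])) mulnC leq_mul2r.
  by rewrite dvdn_leq ?dvdn_gcdr ?orbT ?order_gt0.
move: le1; set q := (X in p * X) => le1 le2.
rewrite (leq_trans (leq_mul (leqnn p) le2)) //.
by rewrite mulnCA mulnC leq_mul.
Qed.

(** * Cyclic groups *)

Lemma dprodX_isog (gT1 gT2 : finGroupType) (H1 : {group gT1})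
    (H2 : {group gT2}) :
  H1 \isog setX H1 [1 gT2]%G /\ H2 \isog setX [1 gT1]%G H2.
Proof.
split.
  rewrite -morphim_pairg1; apply: sub_isog (subsetT _) (injm_pairg1 _ _).
rewrite -morphim_pair1g; apply: sub_isog (subsetT _) (injm_pair1g _ _).
Qed.

Lemma psi_dprodX (gT1 gT2 : finGroupType) (H1 : {group gT1})
    (H2 : {group gT2}) :
  coprime #|H1| #|H2| -> psi (dprodX H1 H2) = psi H1 * psi H2.
Proof.
move=> co12; have [iso1 iso2] := dprodX_isog H1 H2.
rewrite (psi_isog (H := [group of setX H1 [1 gT2]%G]) iso1).
rewrite (psi_isog (H := [group of setX [1 gT1]%G H2]) iso2).
apply: psi_dprod; first exact: setX_dprod.
by rewrite -(card_isog iso1) -(card_isog iso2).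
Qed.

Lemma cyclic_dprodX (gT1 gT2 : finGroupType) (H1 : {group gT1})
    (H2 : {group gT2}) :
  cyclic H1 -> cyclic H2 -> coprime #|H1| #|H2| -> cyclic (dprodX H1 H2).
Proof.
move=> cyc1 cyc2 co12; have [iso1 iso2] := dprodX_isog H1 H2.
rewrite (cyclic_dprod (setX_dprod H1 H2)) -?(isog_cyclic iso1) //.
  by rewrite -(card_isog iso1) -(card_isog iso2).
by rewrite -(isog_cyclic iso2).
Qed.

Lemma psi_cycM a b :
  0 < a -> 0 < b -> coprime a b -> psi (cyc (a * b)) = psi (cyc a) * psi (cyc b).
Proof.
move=> a_gt0 b_gt0 co_ab.
have co_cyc : coprime #|cyc a| #|cyc b| by rewrite !card_cyc.
rewrite -psi_dprodX // [RHS]psi_cyclic ?cyclic_dprodX ?cyc_cyclic //.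
by rewrite /= cardsX !card_cyc.
Qed.

Lemma psi_cyc1 : psi (cyc 1) = 1.
Proof.
apply/eqP; rewrite eqn_leq psi_gt0 andbT.
by rewrite (leq_trans (psi_le_sqr _)) ?card_cyc.
Qed.

(** The elements outside the subgroup of index p are the generators, whence
the recursion psi(p^(r+1)) = psi(p^r) + (p^(r+1) - p^r) p^(r+1). *)
Lemma psi_cyc_pfactor p r :
  prime p -> p.+1 * psi (cyc (p ^ r)) = p ^ (2 * r).+1 + 1.
Proof.
move=> p_pr; have p_gt0 := prime_gt0 p_pr.
elim: r => [|r IHr].
  by rewrite expn0 psi_cyc1 expn1; lia.
have pr_gt0 k : 0 < p ^ k by rewrite expn_gt0 p_gt0.
have oC := card_cyc (pr_gt0 r.+1).
have [x defC] := cyclicP (cyc_cyclic (p ^ r.+1)).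
have ox : #[x] = p ^ r.+1 by rewrite orderE -defC.
have oH : #[x ^+ p] = p ^ r by rewrite orderXdiv ox expnS ?mulKn ?dvdn_mulr.
have sHC : <[x ^+ p]> \subset cyc (p ^ r.+1) by rewrite defC cycleX.
have eH : psi <[x ^+ p]>%G = psi (cyc (p ^ r)).
  by rewrite psi_cyclic ?cycle_cyclic //= -orderE oH.
rewrite (psi_setD sHC) eH.
rewrite (eq_bigr (fun=> p ^ r.+1)) => [|y /setDP[Cy nHy]]; last first.
  have := order_dvdG Cy; rewrite oC => /(dvdn_pfactor _ _ p_pr)[m le_mr oy].
  rewrite oy; congr (_ ^ _); apply/eqP; rewrite eqn_leq le_mr ltnNge.
  apply: contra nHy => le_m; rewrite -cycle_subG.
  rewrite -(cardSg_cyclic (cyc_cyclic (p ^ r.+1))) ?cycle_subG //.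
    by rewrite -!orderE oH oy dvdn_exp2l.
  by rewrite -cycle_subG.
rewrite sum_nat_const cardsD (setIidPr sHC) oC -orderE oH.
rewrite mulnDr IHr.
have -> : (2 * r.+1).+1 = r + (r + 3) by lia.
have -> : (2 * r).+1 = r + r.+1 by lia.
rewrite (expnD p r (r + 3)) (expnD p r 3) (expnD p r r.+1) !expnS expn0.
move: (p ^ r) p_gt0 => X; case: (p) => // s _.
by rewrite mulSn addKn; lia.
Qed.

(** Induction on m: a prime m contributes to psi(C_n)/n^2 a factor larger than
m/(m+1), exactly what the passage from m-1 to m costs in 2/(m+1); if m is not
a prime divisor of n, the bound only gets weaker. *)
Lemma psi_cyc_ge n m :
    0 < n -> 0 < m -> (forall q, prime q -> q %| n -> q <= m) ->
  2 * n ^ 2 <= m.+1 * psi (cyc n).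
Proof.
move=> n_gt0; elim: m n n_gt0 => // m IHm n n_gt0 _ leqm.
case: (posnP m) => [m0|m_gt0].
  have -> : n = 1; last by rewrite psi_cyc1 m0.
  case: (leqP n 1) => [|n_gt1]; first by lia.
  have := leqm _ (pdiv_prime n_gt1) (pdiv_dvd n); rewrite m0.
  by rewrite leqNgt prime_gt1 // pdiv_prime.
have [/andP[p_pr p_n] | np] := boolP (prime m.+1 && (m.+1 %| n)); last first.
  rewrite (leq_trans (IHm n n_gt0 m_gt0 _)) ?leq_mul // => q q_pr q_n.
  have := leqm q q_pr q_n; rewrite leq_eqVlt => /orP[/eqP eq_q|//].
  by rewrite -eq_q q_pr q_n in np.
set p := m.+1 in p_pr p_n leqm *.
have defn := partnC p n_gt0; set k := n`_p^' in defn.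
have k_gt0 : 0 < k := part_gt0 _ _.
have cop : coprime n`_p k by apply: coprime_partC.
rewrite -defn psi_cycM ?part_gt0 // p_part.
have := psi_cyc_pfactor (logn p n) p_pr.
have : 2 * k ^ 2 <= p * psi (cyc k).
  apply: IHm => // q q_pr q_k.
  have := leqm q q_pr (dvdn_trans q_k (dvdn_part _ _)).
  rewrite leq_eqVlt => /orP[/eqP eq_q|//].
  have : p^'.-nat k by apply: part_pnat.
  by move/pnatP => /(_ k_gt0 q q_pr q_k); rewrite eq_q !inE eqxx.
move: (psi _) => A; move: (psi _) => B leA.
rewrite expnS (mulnC 2) expnM; move: (p ^ logn p n) => X eB.
have leB : p * X ^ 2 <= p.+1 * B by rewrite eB leq_addr.
rewrite -(leq_pmul2l (prime_gt0 p_pr)).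
by have := leq_mul leA leB; rewrite !expnMn; lia.
Qed.

(** Z lies in a subgroup of some prime index q, and lowering the exponent of
q by one in the order divides psi by (q^(2r+3) + 1)/(q^(2r+1) + 1) >= 3, with
equality for q = 2 and r = 0. *)
Lemma psi_cyclic_proper (gT : finGroupType) (Z F : {group gT}) :
  cyclic F -> Z \proper F -> 3 * psi Z <= psi F.
Proof.
move=> cycF /andP[sZF nsFZ].
have iZF : 1 < #|F : Z| by rewrite indexg_gt1.
have [q_pr q_i] := (pdiv_prime iZF, pdiv_dvd #|F : Z|).
set q := pdiv _ in q_pr q_i; have q_gt1 := prime_gt1 q_pr.
have oF := Lagrange sZF.
have q_F : q %| #|F| by rewrite -oF dvdn_mull.
have [x defF] := cyclicP cycF.
have ox : #[x] = #|F| by rewrite orderE -defF.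
have oM : #[x ^+ q] = #|F| %/ q by rewrite orderXdiv ox.
have sMF : <[x ^+ q]> \subset F by rewrite defF cycleX.
have sZM : Z \subset <[x ^+ q]>.
  rewrite -(cardSg_cyclic cycF) // -orderE oM -oF -muln_divA //.
  exact: dvdn_mulr.
apply: (leq_trans (leq_mul (leqnn 3) (psi_subset (G := <[x ^+ q]>%G) sZM))).
rewrite (psi_cyclic cycF) (psi_cyclic (cycle_cyclic _)) /= -orderE oM.
have defn := partnC q (cardG_gt0 F); set k := #|F|`_q^' in defn.
have k_gt0 : 0 < k := part_gt0 _ _.
have cop : coprime #|F|`_q k by apply: coprime_partC.
have r_gt0 : 0 < logn q #|F| by rewrite logn_gt0 mem_primes q_pr cardG_gt0.
rewrite p_part -(prednK r_gt0) in defn cop; set r := (logn _ _).-1 in defn cop.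
rewrite -defn.
have -> : (q ^ r.+1 * k) %/ q = q ^ r * k.
  by rewrite expnS -mulnA mulKn ?prime_gt0.
rewrite coprime_pexpl // in cop.
rewrite !psi_cycM ?expn_gt0 ?(ltnW q_gt1) ?coprimeXl // mulnA leq_mul2r.
apply/orP; right.
have e1 := psi_cyc_pfactor r q_pr; have e2 := psi_cyc_pfactor r.+1 q_pr.
rewrite -(leq_pmul2l (ltn0Sn q)) mulnCA e1 e2.
have -> : (2 * r.+1).+1 = ((2 * r).+1).+2 by lia.
rewrite !expnS.
have : 2 * 1 <= q * q ^ (2 * r) by rewrite leq_mul // expn_gt0 ltnW.
move: (q * _) => A leA; rewrite mulnA.
have : 2 * 2 * A <= q * q * A by rewrite !leq_mul.
lia.
Qed.

Lemma psi_pgroup_ge (gT : finGroupType) (p : nat) (P : {group gT}) :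
  prime p -> p.-group P -> 1 + p * #|P|.-1 <= psi P.
Proof.
move=> p_pr pP; rewrite /psi (bigD1 1%g) //= order1 leq_add2l mulnC.
rewrite (cardsD1 1%g) group1 /= -sum_nat_const [leqRHS](eq_bigl (mem (P :\ 1%g))).
  apply: leq_sum => x /setD1P[ntx Px].
  have [m] := p_natP (mem_p_elt pP Px); case: m => [/eqP|m ->].
    by rewrite order_eq1 (negPf ntx).
  by rewrite expnS leq_pmulr ?expn_gt0 ?prime_gt0.
by move=> x; rewrite !inE andbC.
Qed.

(** * Elements of large order *)

(** A Sylow p-subgroup of <[x]> is one of G, since p exceeds the index; it has
fewer than p conjugates, as <[x]> normalizes it. *)
Lemma normal_Sylow_small_index (gT : finGroupType) (p : nat)
    (G : {group gT}) x :
    prime p -> x \in G -> #|G : <[x]>| < p ->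
  exists2 P : {group gT}, p.-Sylow(G) P & P <| G.
Proof.
move=> p_pr Gx lt_ip; have sXG : <[x]> \subset G by rewrite cycle_subG.
have [P sylPX] := Sylow_exists p <[x]>; have [sPX pP _] := and3P sylPX.
have sPG := subset_trans sPX sXG.
have i_gt0 : 0 < #|G : <[x]>| by [].
have sylP : p.-Sylow(G) P.
  rewrite pHallE sPG -(Lagrange sXG) partnM // (card_Hall sylPX).
  rewrite [X in _ * X]part_p'nat ?muln1 ?eqxx //.
  by rewrite p'natE //; apply: contraL lt_ip => /(dvdn_leq i_gt0); rewrite -leqNgt.
exists P => //.
have sXN : <[x]> \subset 'N_G(P).
  rewrite subsetI sXG cents_norm // centsC.
  exact: subset_trans sPX (cycle_abelian x).
have := card_Syl_mod G p_pr; rewrite (card_Syl sylP) modn_small => [|].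
  move/eqP; rewrite indexg_eq1 => sGN.
  by rewrite /normal sPG (subset_trans sGN) ?subsetIr.
apply: leq_ltn_trans lt_ip.
by rewrite dvdn_leq // indexgS.
Qed.

Lemma large_order_element (gT : finGroupType) (G : {group gT}) m :
    0 < m -> (forall q, prime q -> q %| #|G| -> q <= m) ->
    7 * psi (cyc #|G|) <= 11 * psi G ->
  exists x, [/\ x \in G, 14 * #|G : <[x]>| <= 11 * m.+1
     & {in G, forall y, #[y] <= #[x]}].
Proof.
move=> m_gt0 leqm leG; have G_gt0 := cardG_gt0 G.
case: (@arg_maxnP _ 1%g (mem G) (fun y => #[y]) (group1 G)) => x Gx maxx.
exists x; split=> //.
have leGx := psi_le_mul maxx.
have leC := psi_cyc_ge G_gt0 m_gt0 leqm.
have ox := order_gt0 x; have sXG : <[x]> \subset G by rewrite cycle_subG.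
have oG := Lagrange sXG; rewrite -orderE in oG.
have lt1 : 14 * #|G| ^ 2 <= m.+1 * (11 * (#|G| * #[x])).
  have := leq_mul (leqnn m.+1) (leq_trans leG (leq_mul (leqnn 11) leGx)).
  by move: leC; lia.
rewrite -(leq_pmul2l ox) -(leq_pmul2l G_gt0).
rewrite expnS expn1 -{2}oG /= in lt1.
by move: lt1; move: #|G : _| => i; move: #|G| #[x] => n o; lia.
Qed.

(** Some maximal subgroup X = <[x]> is cyclic.  Bounding all orders outside X
by |X| gives 33 psi(G) <= 55 |X|^2 + 11, against 21 psi(C_n) = 56 |X|^2 + 7. *)
Lemma near_extremal_2group (gT : finGroupType) (G : {group gT}) :
    2.-group G -> ~~ cyclic G -> 7 * psi (cyc #|G|) <= 11 * psi G ->
  #|G| = 4 /\ 11 * psi G = 7 * psi (cyc #|G|).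
Proof.
move=> pG ncG leG; have [a oG] := p_natP pG.
have [|x [Gx le_ix maxx]] := @large_order_element _ G 2 isT _ leG.
  by move=> q q_pr; rewrite oG Euclid_dvdX // => /andP[/dvdn_leq->].
have sXG : <[x]> \subset G by rewrite cycle_subG.
have iX : #|G : <[x]>| = 2.
  have : #|G : <[x]>| != 1.
    rewrite indexg_eq1; apply: contra ncG => sGX.
    by rewrite (cyclicS sGX) ?cycle_cyclic.
  have : 0 < #|G : <[x]>| by [].
  by move: le_ix; move: #|G : _| => i; lia.
have := Lagrange sXG; rewrite iX -orderE => oxG.
have a_gt0 : 0 < a.
  by rewrite lt0n; apply: contra_eq_neq oxG => a0; rewrite oG a0; lia.
have ox : #[x] = 2 ^ a.-1.
  by move: oxG; rewrite oG -(prednK a_gt0) expnS /=; lia.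
have leS : psi G <= psi <[x]>%G + #[x] * #[x].
  rewrite (psi_setD sXG) leq_add2l.
  have -> : #[x] * #[x] = \sum_(y in G :\: <[x]>) #[x].
    by rewrite sum_nat_const cardsD (setIidPr sXG) -oxG -orderE muln2 -addnn addnK.
  by apply: leq_sum => y /setDP[Gy _]; apply: maxx.
have ex : psi <[x]>%G = psi (cyc (2 ^ a.-1)).
  by rewrite psi_cyclic ?cycle_cyclic //= -orderE ox.
have := psi_cyc_pfactor a.-1 (isT : prime 2).
have := psi_cyc_pfactor a (isT : prime 2).
rewrite -oG -ex.
have -> : 2 ^ (2 * a).+1 = 8 * #[x] ^ 2.
  by rewrite ox -expnM -(expnD 2 3); congr (2 ^ _); lia.
have -> : 2 ^ (2 * a.-1).+1 = 2 * #[x] ^ 2.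
  by rewrite ox -expnM -(expnS 2); congr (2 ^ _); lia.
have ox_gt1 : 1 < #[x].
  rewrite ltnNge; apply: contra ncG => le_x1; apply: prime_cyclic.
  by rewrite -oxG; have := order_gt0 x; case: #[x] le_x1 => [|[|]].
rewrite expnS expn1 => e1 e2.
have le_xx : #[x] * #[x] <= 4.
  move: leG leS e1 e2;
  move: (psi (cyc #|G|)) (psi G) (psi <[x]>%G) (#[x] * #[x]) => b c d t.
  lia.
have ox2 : #[x] = 2.
  by move: ox_gt1 le_xx; move: #[x] => [|[|[|k]]] // _; rewrite !mulSn; lia.
rewrite ox2 in oxG e1 e2 leS; split; first by rewrite -oxG.
move: leG leS e1 e2; move: (psi (cyc #|G|)) (psi G) (psi <[x]>%G) => b c d; lia.
Qed.

(** The bound 14 |G : <[x]>| <= 11 (p+1) does not exclude index 3 for p = 3,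
but it ignores small orders.  The squares in <[x]>, a sixth of G, have order at
most half the maximum: with n = 6k this gives psi(G) <= k^2 + 5k (2k) = 11 k^2,
against psi(C_n) >= 18 k^2. *)
Lemma psi_even_index3_lt (gT : finGroupType) (G : {group gT}) x :
    x \in G -> #|G : <[x]>| = 3 -> 2 %| #|G| ->
    {in G, forall y, #[y] <= #[x]} ->
    (forall q, prime q -> q %| #|G| -> q <= 3) ->
  11 * psi G < 7 * psi (cyc #|G|).
Proof.
move=> Gx iX G_even maxx leq3.
have sXG : <[x]> \subset G by rewrite cycle_subG.
have := Lagrange sXG; rewrite iX -orderE => oxG.
have := psi_cyc_ge (cardG_gt0 G) (isT : 0 < 3) leq3.
have x_even : 2 %| #[x] by rewrite -oxG Gauss_dvdl in G_even.
have oy : #[x ^+ 2] = #[x] %/ 2 by rewrite orderXdiv.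
have [k ox] := dvdnP x_even; rewrite ox mulnK // in oy.
have sYG : <[x ^+ 2]> \subset G by rewrite cycle_subG groupX.
have leY := psi_le_sqr <[x ^+ 2]>%G; rewrite /= -orderE oy in leY.
have leD : \sum_(y in G :\: <[x ^+ 2]>) #[y] <= 5 * k * (2 * k).
  have -> : 5 * k = #|G :\: <[x ^+ 2]>|.
    by rewrite cardsD (setIidPr sYG) -orderE oy -oxG ox; lia.
  rewrite -sum_nat_const; apply: leq_sum => y /setDP[Gy _].
  by rewrite mulnC -ox maxx.
have k_gt0 : 0 < k by rewrite -oy order_gt0.
rewrite (psi_setD sYG) -{1}oxG ox => leC.
have k2_gt0 : 0 < k * k by rewrite muln_gt0 k_gt0.
move: leC leY leD; rewrite !expnS !expn0 !muln1.
move: (psi (cyc #|G|)) (psi _) (\sum_(y in _) _) => c y d.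
lia.
Qed.

(** * The induction *)

(** The extremal groups in internal form: unlike an isomorphism type, the two
factors can be extended inside a larger group. *)
Definition klein_by_odd_cyclic (gT : finGroupType) (G : {group gT}) :=
  exists A B : {group gT},
    [/\ A \x B = G, #|A| = 4, ~~ cyclic A, cyclic B & odd #|B|].

Lemma near_extremal_normal_Sylow (gT : finGroupType) (p : nat)
    (G : {group gT}) :
    prime p -> 2 < p -> (forall q, prime q -> q %| #|G| -> q <= p) ->
    7 * psi (cyc #|G|) <= 11 * psi G ->
  exists2 P : {group gT}, p.-Sylow(G) P & P <| G.
Proof.
move=> p_pr p_gt2 leqp leG.
have [x [Gx le_ix maxx]] := large_order_element (ltnW (ltnW p_gt2)) leqp leG.
case: (ltnP #|G : <[x]>| p) => [lt_ip | le_pi].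
  exact: normal_Sylow_small_index Gx lt_ip.
have [p3 i3] : p = 3 /\ #|G : <[x]>| = 3.
  by move: le_ix le_pi; move: #|G : _| => i; lia.
move: p3 leqp => -> leq3.
have [G_even|G_odd] := boolP (2 %| #|G|).
  by move: leG; rewrite leqNgt (psi_even_index3_lt Gx i3 G_even maxx leq3).
exists G => //; rewrite pHallE subxx /= part_pnat_id //.
apply/pnatP=> // q q_pr q_G; have := leq3 q q_pr q_G.
by case: q q_pr q_G => [|[|[|[|q]]]] // _ G2; rewrite G2 in G_odd.
Qed.

Lemma psi_odd_pgroup (gT : finGroupType) (p : nat) (P : {group gT}) :
  prime p -> 2 < p -> p.-group P -> P :!=: 1%g -> 7 * #|P| <= 3 * psi P.
Proof.
move=> p_pr p_gt2 pP ntP.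
have lePp : 3 * #|P|.-1 <= p * #|P|.-1 by rewrite leq_mul.
have := psi_pgroup_ge p_pr pP; move: lePp.
have : p <= #|P|.
  by have [_ pdP _] := pgroup_pdiv pP ntP; rewrite dvdn_leq.
by move: (p * #|P|.-1) #|P| (psi P); lia.
Qed.

(** A coset of P contributes psi(P) #[f] if f centralizes P and |P| #[f]
otherwise, which is less since P is then nontrivial. *)
Lemma psi_sdprod_cyclic_leqif (gT : finGroupType) (p : nat)
    (G P F : {group gT}) :
    P ><| F = G -> p.-group P -> cyclic P -> coprime #|P| #|F| ->
  psi G <= psi P * psi F ?= iff (F \subset 'C(P)).
Proof.
move=> defG pP cycP coPF.
have [cPF|ncPF] := boolP (F \subset 'C(P)).
  rewrite (psi_dprod (etrans (dprodEsd cPF) defG) coPF).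
  exact/leqif_refl.
have ntP : P :!=: 1%g by apply: contraNneq ncPF => ->; rewrite cents1.
have [p_pr _ _] := pgroup_pdiv pP ntP.
have ltP : #|P| < psi P.
  have le2 : 2 * #|P|.-1 <= p * #|P|.-1 by rewrite leq_mul ?prime_gt1.
  have := psi_pgroup_ge p_pr pP; move: le2.
  by move: ntP; rewrite -cardG_gt1; move: (p * #|P|.-1) #|P| (psi P); lia.
have := psi_proper (_ : 'C_F(P)%G \proper F).
rewrite properE subsetIl subsetI subxx ncPF => /(_ isT).
rewrite (psi_setD (subsetIl F 'C(P))) setDIr setDv set0U.
rewrite (psi_sdprod_cyclic_pgroup defG pP cycP coPF) mulnDr.
rewrite -[ltnLHS]addn0 ltn_add2l => s_gt0.
have lt_ab : #|P| * \sum_(f in F :\: 'C(P)) #[f]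
             < psi P * \sum_(f in F :\: 'C(P)) #[f] by rewrite ltn_pmul2r.
by split; [rewrite leq_add2l ltnW | rewrite eqn_add2l ltn_eqF].
Qed.

(** With Z = 'C_F(P) a proper subgroup of F, the ratio psi(G)/(psi(P) psi(F))
is z + c (1 - z), where z = psi(Z)/psi(F) <= 1/3 and c = |P|/psi(P) <= 3/7.
This is at most 13/21, which is less than 7/11. *)
Lemma psi_cyclic_by_cyclic_lt (gT : finGroupType) (p : nat)
    (G P F : {group gT}) :
    prime p -> 2 < p -> P ><| F = G -> p.-group P -> P :!=: 1%g -> cyclic P ->
    cyclic F -> coprime #|P| #|F| -> ~~ cyclic G ->
  11 * psi G < 7 * (psi P * psi F).
Proof.
move=> p_pr p_gt2 defG pP ntP cycP cycF coPF ncG.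
have ltZF : 'C_F(P) \proper F.
  rewrite properE subsetIl subsetI subxx /=; apply: contra ncG => cPF.
  by rewrite (cyclic_dprod _ cycP cycF) // dprodEsd.
have leZ := psi_cyclic_proper (Z := 'C_F(P)%G) cycF ltZF.
have leP := psi_odd_pgroup p_pr p_gt2 pP ntP.
have := psi_sdprod_cyclic_pgroup defG pP cycP coPF.
have := psi_setD (subsetIl F 'C(P)); rewrite setDIr setDv set0U /=.
have := psi_gt0 P; have := psi_gt0 F.
move: leP leZ.
move: (psi P) (psi F) (psi G) (psi 'C_F(P)%G) #|P| (\sum_(f in _) _).
move=> a b g z c s leP leZ b_gt0 a_gt0 eb eg.
have le1 : 7 * c * s <= 3 * a * s by rewrite leq_mul.
have le2 : 3 * (a * z) <= a * b by rewrite mulnCA leq_mul.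
have ab_gt0 : 0 < a * b by rewrite muln_gt0 a_gt0.
rewrite {}eg; rewrite {}eb (mulnDr a) in le2 ab_gt0 *.
move: ab_gt0 le1 le2; rewrite -!mulnA.
by move: (a * z) (c * s) (a * s); lia.
Qed.

(** Here psi(G) <= (|P|^2/p) psi(F), while psi(C_|P|) > |P|^2 p/(p+1); the
ratio is below (p+1)/p^2 <= 4/9 < 7/11. *)
Lemma psi_noncyclic_Sylow_lt (gT : finGroupType) (p : nat)
    (G P F : {group gT}) :
    prime p -> 2 < p -> P ><| F = G -> p.-group P -> ~~ cyclic P ->
  11 * psi G < 7 * (psi (cyc #|P|) * psi F).
Proof.
move=> p_pr p_gt2 defG pP ncP.
have leG := psi_sdprod_noncyclic_pgroup p_pr defG pP ncP.
have [r oP] := p_natP pP.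
have := psi_cyc_pfactor r p_pr; rewrite -oP.
have -> : p ^ (2 * r).+1 = p * #|P| ^ 2 by rewrite oP -expnM mulnC expnS.
have := psi_gt0 F.
move: leG; move: (psi (cyc #|P|)) (psi F) (psi G) (#|P| ^ 2) =>
  a b g s leG b_gt0 ea.
(* Clear the denominators p and p + 1 of the two bounds. *)
rewrite -(ltn_pmul2l (ltnW (ltnW p_gt2))) -(ltn_pmul2l (ltn0Sn p)).
have -> : p.+1 * (p * (7 * (a * b))) = 7 * p * (p.+1 * a) * b.
  by rewrite -!mulnA; lia.
have -> : p.+1 * (p * (11 * g)) = 11 * (p * (p * g) + p * g) by lia.
have -> : 7 * p * (p.+1 * a) * b = 7 * (p * (p * (s * b)) + p * b).
  by rewrite ea; lia.
have le1 : p * (p * g) <= p * (s * b) by rewrite leq_mul.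
have le2 : 3 * (p * (s * b)) <= p * (p * (s * b)) by rewrite leq_mul.
have le3 : 3 * (s * b) <= p * (s * b) by rewrite leq_mul.
have : 0 < p * b by rewrite muln_gt0 b_gt0 prime_gt0.
move: leG le1 le2 le3.
move: (p * (p * g)) (p * (p * (s * b))) (p * (s * b)) (s * b) (p * g) (p * b).
lia.
Qed.

(** The lower bound on psi(G) is also what makes the induction hypothesis
applicable to the complement F, through psi(G) <= psi(P) psi(F). *)
Lemma near_extremal (gT : finGroupType) (G : {group gT}) :
    ~~ cyclic G -> 7 * psi (cyc #|G|) <= 11 * psi G ->
  11 * psi G = 7 * psi (cyc #|G|) /\ klein_by_odd_cyclic G.
Proof.
have [m] := ubnP #|G|; elim: m G => // m IHm G /ltnSE-leGm ncG leG.
have G_gt1 : 1 < #|G|.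
  by rewrite cardG_gt1; apply: contraNneq ncG => ->; apply: cyclic1.
set p := max_pdiv #|G|.
have p_pr : prime p by apply: max_pdiv_prime.
have p_G : p %| #|G| by apply: max_pdiv_dvd.
have leqp q : prime q -> q %| #|G| -> q <= p.
  by move=> q_pr q_G; apply: max_pdiv_max; rewrite mem_primes q_pr cardG_gt0.
have [p2|p_neq2] := eqVneq p 2.
  have pG : 2.-group G.
    apply/pnatP=> // q q_pr q_G; have := leqp q q_pr q_G; rewrite p2.
    by have := prime_gt1 q_pr; case: q {q_pr q_G} => [|[|[|]]].
  have [oG eqG] := near_extremal_2group pG ncG leG; split=> //.
  by exists G, 1%G; rewrite dprodg1 cards1 cyclic1.
have p_gt2 : 2 < p by rewrite ltn_neqAle eq_sym p_neq2 prime_gt1.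
have [P sylP nPG] := near_extremal_normal_Sylow p_pr p_gt2 leqp leG.
have [sPG pP _] := and3P sylP.
have /splitsP[F /complP[tiPF defPF]] := SchurZassenhaus_split (pHall_Hall sylP) nPG.
have nPF : F \subset 'N(P).
  by apply: subset_trans (normal_norm nPG); rewrite -defPF mulG_subr.
have defG : P ><| F = G by rewrite sdprodE.
have oG := sdprod_card defG.
have coPF : coprime #|P| #|F|.
  have : F \in [complements to P in G] by apply/complP.
  rewrite (compl_pHall _ sylP) => /pHall_pgroup p'F.
  exact: pnat_coprime pP p'F.
have ntP : P :!=: 1%g.
  rewrite -cardG_gt1 (card_Hall sylP) p_part.
  by rewrite -(expn0 p) ltn_exp2l ?prime_gt1 // logn_gt0 mem_primes p_pr cardG_gt0.
have ltFG : #|F| < #|G|.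
  by rewrite -oG ltn_Pmull ?cardG_gt1 ?cardG_gt0.
have IHF := IHm F (leq_trans ltFG leGm).
have eC : psi (cyc #|G|) = psi (cyc #|P|) * psi (cyc #|F|).
  by rewrite -oG psi_cycM ?cardG_gt0.
(* psi(F) > psi(C_|F|) would make F near-extremal, so of ratio exactly 7/11. *)
have leF : psi F <= psi (cyc #|F|).
  have [cycF | ncF] := boolP (cyclic F); first by rewrite (psi_cyclic cycF).
  rewrite leqNgt; apply/negP=> ltF.
  have [|eqF _] := IHF ncF; first by rewrite leq_mul // ltnW.
  by rewrite -(ltn_pmul2l (isT : 0 < 11)) eqF ltn_mul2r andbF in ltF.
have cycP : cyclic P.
  apply: contraLR leG => ncP; rewrite -ltnNge eC.
  apply: leq_trans (psi_noncyclic_Sylow_lt p_pr p_gt2 defG pP ncP) _.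
  by rewrite !leq_mul.
have ncF : ~~ cyclic F.
  apply: contraL leG => cycF; rewrite -ltnNge eC -!psi_cyclic //.
  exact: psi_cyclic_by_cyclic_lt p_pr p_gt2 defG pP ntP cycP cycF coPF ncG.
rewrite eC -(psi_cyclic cycP) in leG *.
have [leGPF eqGPF] := psi_sdprod_cyclic_leqif defG pP cycP coPF.
have leF' : 7 * psi (cyc #|F|) <= 11 * psi F.
  rewrite -(leq_pmul2l (psi_gt0 P)) !(mulnCA (psi P)).
  by rewrite (leq_trans leG) ?leq_mul.
have [eqF [A [B [defF oA ncA cycB oddB]]]] := IHF ncF leF'.
have eqG : psi G = psi P * psi F.
  apply/eqP; rewrite eqn_leq leGPF -(leq_pmul2l (isT : 0 < 11)).
  by rewrite mulnCA eqF mulnCA.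
have cPF : F \subset 'C(P) by rewrite -eqGPF eqG.
split; first by rewrite eqG mulnCA eqF mulnCA.
have [_ defAB cAB tiAB] := dprodP defF.
have [sAF sBF] : A \subset F /\ B \subset F.
  by rewrite -defAB mulG_subl mulG_subr.
have defPB : P \x B = P <*> B.
  rewrite dprodEY // ?(subset_trans sBF) //.
  by apply/trivgP; rewrite -tiPF setIS.
(* P is central of odd order prime to |B|: it is absorbed in the cyclic part. *)
exists A, (P <*> B)%G; split => //.
- rewrite /= -defPB dprodA (dprodC A) -dprodA defF dprodEsd //.
- rewrite (cyclic_dprod defPB) //; exact: coprime_dvdr (cardSg sBF) coPF.
rewrite -(dprod_card defPB) oddM oddB andbT.
have [k ->] := p_natP pP; rewrite oddX; apply/orP; right.
by case: (even_prime p_pr) p_gt2 => [->|].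
Qed.

(** * The extremal groups *)

Lemma order_card4_noncyclic (gT : finGroupType) (A : {group gT}) x :
  #|A| = 4 -> ~~ cyclic A -> x \in A -> x != 1%g -> #[x] = 2.
Proof.
move=> oA ncA Ax ntx; have := order_dvdG Ax; rewrite oA => x4.
have x_neq4 : #[x] != 4.
  apply: contraNneq ncA => ox; apply/cyclicP; exists x.
  by apply/esym/eqP; rewrite eqEcard cycle_subG Ax -orderE ox oA.
have := dvdn_leq (isT : 0 < 4) x4; rewrite -order_eq1 in ntx.
by move: x4 ntx x_neq4; case: #[x] => [|[|[|[|[|]]]]].
Qed.

Lemma abelem_card4_noncyclic (gT : finGroupType) (A : {group gT}) :
  #|A| = 4 -> ~~ cyclic A -> 2.-abelem A.
Proof.
move=> oA ncA; rewrite abelemE // (card_p2group_abelian (p := 2)) //=.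
apply/exponentP=> x Ax; have [-> | ntx] := eqVneq x 1%g; first exact: expg1n.
by rewrite -(order_card4_noncyclic oA ncA Ax ntx) expg_order.
Qed.

Lemma psi_card4_noncyclic (gT : finGroupType) (A : {group gT}) :
  #|A| = 4 -> ~~ cyclic A -> psi A = 7.
Proof.
move=> oA ncA; rewrite /psi (bigD1 1%g) //= order1.
rewrite (eq_bigr (fun=> 2)) => [|x /andP[Ax ntx]]; last first.
  exact: order_card4_noncyclic oA ncA Ax ntx.
rewrite (eq_bigl (mem (A :\ 1%g))) => [|x]; last by rewrite !inE andbC.
rewrite sum_nat_const (_ : #|_| = 3) //.
by apply/eqP; rewrite -eqSS -oA (cardsD1 1%g A) group1.
Qed.

Lemma noncyclic_klein : ~~ cyclic (dprodX (cyc 2) (cyc 2)).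
Proof.
have [iso1 iso2] := dprodX_isog (cyc 2) (cyc 2).
rewrite (cyclic_dprod (setX_dprod (cyc 2) (cyc 2))).
- by rewrite -(card_isog iso1) -(card_isog iso2) card_cyc.
- by rewrite -(isog_cyclic iso1) cyc_cyclic.
by rewrite -(isog_cyclic iso2) cyc_cyclic.
Qed.

Lemma card_klein : #|dprodX (cyc 2) (cyc 2)| = 4.
Proof. by rewrite cardsX !card_cyc. Qed.

Lemma psi_cyc_4 k : 0 < k -> coprime k 2 -> psi (cyc (4 * k)) = 11 * psi (cyc k).
Proof.
move=> k_gt0 co_k2; rewrite psi_cycM //; last first.
  by rewrite -[4]/(2 ^ 2) coprimeXl // coprime_sym.
congr (_ * _); apply/eqP; rewrite -(eqn_pmul2l (isT : 0 < 3)).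
exact/eqP/(psi_cyc_pfactor 2 (isT : prime 2)).
Qed.

Lemma klein_by_odd_cyclic_isog (gT : finGroupType) (G : {group gT}) :
    klein_by_odd_cyclic G ->
  exists k, [/\ 0 < k, #|G| = 4 * k, coprime k 2
    & G \isog dprodX (dprodX (cyc 2) (cyc 2)) (cyc k)].
Proof.
case=> A [B [defG oA ncA cycB oddB]]; exists #|B|; split=> //.
- by rewrite -(dprod_card defG) oA.
- by rewrite coprimen2.
have [iso1 iso2] := dprodX_isog (dprodX (cyc 2) (cyc 2)) (cyc #|B|).
apply: isog_dprod defG (setX_dprod _ _) _ _.
  apply: isog_trans iso1; rewrite (isog_abelem_card _ (abelem_card4_noncyclic oA ncA)).
  by rewrite abelem_card4_noncyclic ?card_klein ?noncyclic_klein ?oA.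
apply: isog_trans iso2.
by rewrite isog_cyclic_card // cyc_cyclic card_cyc ?cardG_gt0 /=.
Qed.

Theorem theorem3 (gT : finGroupType) (G : {group gT}) (n : nat)
    (oG : #|G| = n) (ncG : ~~ cyclic G) :
  ((psi G)%:R <= 7%:R / 11%:R * (psi (cyc n))%:R :> rat)%R /\
  (((psi G)%:R = 7%:R / 11%:R * (psi (cyc n))%:R :> rat)%R <->
   (exists k : nat, [/\ (0 < k)%N, n = (4 * k)%N, coprime k 2
      & G \isog dprodX (dprodX (cyc 2) (cyc 2)) (cyc k)])).
Proof.
have near := near_extremal ncG; rewrite oG in near.
set c := psi (cyc n) in near *.
have le_nat : 11 * psi G <= 7 * c.
  by rewrite leqNgt; apply/negP=> lt; have [eq _] := near (ltnW lt); rewrite eq ltnn in lt.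
have ratE (a b : nat) : (a%:R <= 7%:R / 11%:R * b%:R :> rat)%R = (11 * a <= 7 * b).
  by rewrite -(Num.Theory.ler_nat rat) !GRing.natrM; apply/idP/idP; lra.
have eqE : ((psi G)%:R = 7%:R / 11%:R * c%:R :> rat)%R <-> 11 * psi G = 7 * c.
  split=> [eq | /(congr1 (fun m => m%:R : rat)%R)]; last by rewrite !GRing.natrM; lra.
  apply/eqP; rewrite -(Num.Theory.eqr_nat rat) !GRing.natrM; apply/eqP; lra.
split; first by rewrite ratE.
apply: (iff_trans eqE); split=> [eq | [k [k_gt0 en co_k2 isoG]]].
  have [|_ /klein_by_odd_cyclic_isog] := near; first by rewrite eq.
  by rewrite oG.
rewrite /c en psi_cyc_4 // (psi_isog isoG) psi_dprodX.
  by rewrite (psi_card4_noncyclic card_klein noncyclic_klein); lia.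
by rewrite card_klein card_cyc // -[4]/(2 ^ 2) coprimeXl // coprime_sym.
Qed.
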